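(* Let $X$ be a Tychonoff space that is Dieudonné complete and Ascoli (in particular, $X$ may be any paracompact $k$-space or any metrizable space). Then the free locally convex space $L(X)$ has a $\mathfrak{G}$-base if and only if $C_k(X)$ has a compact resolution swallowing the compact subsets of $C_k(X)$.
   Context: $\mathbb{N}^{\mathbb{N}}$ is ordered coordinatewise: $\alpha\le\beta$ iff $\alpha(n)\le\beta(n)$ for all $n\in\mathbb{N}$. $\mathfrak{G}$-base: a topological space $Z$ has a $\mathfrak{G}$-base at $z\in Z$ if it has a base $\{U_\alpha:\alpha\in\mathbb{N}^{\mathbb{N}}\}$ of neighborhoods at $z$ such that $U_\beta\subseteq U_\alpha$ whenever $\alpha\le\beta$; $Z$ has a $\mathfrak{G}$-base if it has one at each of its points. Free locally convex space: $L(X)$ is a (real, Hausdorff) locally convex space together with a continuous map $i:X\to L(X)$ such that for every continuous map $f$ from $X$ to a locally convex space $E$ there is a unique continuous linear operator $\bar f:L(X)\to E$ with $f=\bar f\circ i$. It exists and is unique up to isomorphism. $C_k(X)$ is the space $C(X)$ of all continuous real-valued functions on $X$ with the compact-open topology. $X$ is an Ascoli space if every compact subset $\mathcal{K}$ of $C_k(X)$ is evenly continuous, i.e. the map $\mathcal{K}\times X\to\mathbb{R}$, $(f,x)\mapsto f(x)$, is continuous. $X$ is Dieudonné complete if its topology is induced by some complete uniformity. A compact resolution in a space $Z$ is a family $\{K_\alpha:\alpha\in\mathbb{N}^{\mathbb{N}}\}$ of compact subsets covering $Z$ with $K_\alpha\subseteq K_\beta$ whenever $\alpha\le\beta$; it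 swallows compact sets if every compact $K\subseteq Z$ is contained in some $K_\alpha$. *)

(* Defs.v *)
From HB Require Import structures.
From mathcomp Require Import all_boot all_order all_algebra.
From mathcomp Require Import all_classical all_reals all_analysis.

Set Implicit Arguments.
Unset Strict Implicit.
Unset Printing Implicit Defensive.

Import Order.TTheory GRing.Theory Num.Theory.
Import numFieldNormedType.Exports.

Local Open Scope classical_set_scope.
Local Open Scope ring_scope.

Definition baire_le (a b : nat -> nat) : Prop := forall n, (a n <= b n)%N.

Definition G_base_at (Z : topologicalType) (z : Z) : Prop :=
  exists U : (nat -> nat) -> set Z,
    [/\ forall a, nbhs z (U a),
        forall V, nbhs z V -> exists a, U a `<=` V
      & forall a b, baire_le a b -> U b `<=` U a].

Definition has_G_base (Z : topologicalType) : Prop :=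
  forall z : Z, G_base_at z.

Definition compact_resolution (Z : topologicalType)
    (K : (nat -> nat) -> set Z) : Prop :=
  [/\ forall a, compact (K a),
      \bigcup_a K a = [set: Z]
    & forall a b, baire_le a b -> K a `<=` K b].

Definition swallows_compacts (Z : topologicalType)
    (K : (nat -> nat) -> set Z) : Prop :=
  forall C : set Z, compact C -> exists a, C `<=` K a.

(* Complete regularity is phrased in the library with a uniformity; by
   [uniform_separatorP] this amounts to separation by a continuous function
   into [0, 1]. *)
Definition tychonoff_space (X : topologicalType) : Prop :=
  hausdorff_space X /\ completely_regular_space X.

(* The uniformity is quantified as a uniform structure on the carrier of [X]
   with the same neighborhoods. Convergence is spelled out because the
   library's [cvg] and [completeType] require a pointed space. *)
Definition dieudonne_complete (X : topologicalType) : Prop :=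
  exists uX : Uniform.axioms_ X,
    let UX : uniformType := Uniform.Pack uX in
    (forall x : X, @nbhs UX UX x = @nbhs X X x) /\
    (forall F : set_system UX, ProperFilter F -> cauchy F ->
       exists x : UX, F --> x).

Definition Ck (R : realType) (X : topologicalType) : Type :=
  continuousType X R.

HB.instance Definition _ (R : realType) (X : topologicalType) :=
  Topological.copy (Ck R X)
    (initial_topology (id : continuousType X R -> {compact-open, X -> R})).

Definition Ck_eval (R : realType) (X : topologicalType)
    (p : Ck R X * X) : R :=
  (p.1 : continuousType X R) p.2.

Definition evenly_continuous (R : realType) (X : topologicalType)
    (K : set (Ck R X)) : Prop :=
  {within K `*` [set: X], continuous (@Ck_eval R X)}.

Definition ascoli_space (R : realType) (X : topologicalType) : Prop :=
  forall K : set (Ck R X), compact K -> evenly_continuous K.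

(* Locally convex spaces are Hausdorff, both [L] and the test spaces [E]. *)
Definition free_lcs (R : realType) (X : topologicalType)
    (L : tvsType R) (i : X -> L) : Prop :=
  [/\ hausdorff_space L,
      continuous i
    & forall (E : tvsType R) (f : X -> E),
        hausdorff_space E -> continuous f ->
        exists! g : L -> E, [/\ linear g, continuous g & f = g \o i]].

Definition locally_finite (X : topologicalType) (D : set (set X)) : Prop :=
  forall x : X, exists2 N, nbhs x N & finite_set [set V | D V /\ V `&` N !=set0].

(* No separation axiom is included here. *)
Definition paracompact_space (X : topologicalType) : Prop :=
  forall C : set (set X), C `<=` open -> \bigcup_(U in C) U = [set: X] ->
  exists D : set (set X),
    [/\ D `<=` open,
        \bigcup_(V in D) V = [set: X],
        forall V, D V -> exists2 U, C U & V `<=` U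
      & locally_finite D].

(* [A : set (subspace K)] closed means that [A `&` K] is closed in [K], since
   the points outside [K] are isolated in [subspace K]. *)
Definition k_space (X : topologicalType) : Prop :=
  forall A : set X,
    (forall K : set X, compact K -> closed (A : set (subspace K))) -> closed A.

Definition metrizable_space (R : realType) (X : topologicalType) : Prop :=
  exists mX : Metric.axioms_ R X,
    let MX : metricType R := Metric.Pack mX in
    forall x : X, @nbhs MX MX x = @nbhs X X x.

(* Main.v *)
Require Import Defs.
From HB Require Import structures.
From mathcomp Require Import all_boot all_order all_algebra.
From mathcomp Require Import all_classical all_reals all_analysis.
From mathcomp Require Import ring lra.

(* The universal property identifies [C(X)] with the dual of [L]. If [U] is a
   neighborhood of 0 in [L], its polar in [C(X)] is equicontinuous and pointwise
   bounded, hence compact in [Ck] (Ascoli). Conversely, if [K] is compact in [Ck]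
   and [X] is Ascoli, then [K] is equicontinuous and pointwise bounded, so
   [x |-> (f x)_(f in K)] is a continuous map into the bounded functions on [K];
   it extends to [L], which shows that the polar of [K] in [L] is a neighborhood
   of 0. Polarity therefore exchanges G-bases at 0 and compact resolutions
   swallowing compact sets; that polars form a base is the Hahn-Banach theorem.

   A paracompact Hausdorff space is complete for the uniformity of all
   neighborhoods of the diagonal, and a metrizable space for that of all
   continuous pseudometrics. Compact subsets of [Ck] are equicontinuous along
   each compact set, and both k-spaces and metrizable spaces have their topology
   determined by compact sets. *)

Set Implicit Arguments.
Unset Strict Implicit.
Unset Printing Implicit Defensive.

Import Order.TTheory GRing.Theory Num.Theory.
Import numFieldNormedType.Exports.

Local Open Scope classical_set_scope.
Local Open Scope ring_scope.

(** * Hahn-Banach by minimal sublinear functionals *)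

(** One inequality, and only for [0 < t], is easier to check for infima; equality follows by
    applying it to [t^-1]. *)
Definition sublinear (R : realType) (V : lmodType R) (q : V -> R) : Prop :=
  (forall x y, q (x + y) <= q x + q y) /\
  (forall (t : R) x, 0 < t -> q (t *: x) <= t * q x).

Section HahnBanach.
Context (R : realType) (V : lmodType R).
Implicit Types x y v : V.

Lemma sublinearZ (q : V -> R) t x : sublinear q -> 0 < t -> q (t *: x) = t * q x.
Proof.
move=> [_ qZ] t0; apply/eqP; rewrite eq_le qZ//=.
have /(qZ _ (t *: x)) : 0 < t^-1 by rewrite invr_gt0.
by rewrite scalerA mulVf ?gt_eqF// scale1r -ler_pdivrMl ?invr_gt0// invrK.
Qed.

Lemma sublinear0 (q : V -> R) : sublinear q -> q 0 = 0.
Proof.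
move=> sq; have := sublinearZ 0 sq (@ltr0n R 2).
rewrite scaler0 => /eqP; lra.
Qed.

Lemma sublinearN_ge (q : V -> R) x : sublinear q -> - q (- x) <= q x.
Proof.
move=> sq; have := sq.1 x (- x); rewrite subrr (sublinear0 sq); lra.
Qed.

(** Used for the shifts, for lower bounds of chains and for the Minkowski gauge. *)
Lemma inf_sublinear (S : V -> set R) :
  (forall x, S x !=set0) -> (forall x, has_lbound (S x)) ->
  (forall x y a b, S x a -> S y b -> exists2 c, S (x + y) c & c <= a + b) ->
  (forall t x a, 0 < t -> S x a -> exists2 c, S (t *: x) c & c <= t * a) ->
  sublinear (fun x => inf (S x)).
Proof.
move=> S0 Sb SD SZ; split=> [x y|t x t0].
  rewrite leNgt; apply/negP => h.
  have /(inf_lt (S0 x))[a Sa ha] : inf (S x) < inf (S (x + y)) - inf (S y).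
    by lra.
  have /(inf_lt (S0 y))[b Sb' hb] : inf (S y) < inf (S (x + y)) - a by lra.
  have [c Sc hc] := SD _ _ _ _ Sa Sb'.
  have := ge_inf (Sb _) Sc; lra.
rewrite leNgt; apply/negP => h.
have /(inf_lt (S0 x))[a Sa] : inf (S x) < t^-1 * inf (S (t *: x)).
  by rewrite ltr_pdivlMl.
rewrite ltr_pdivlMl// => ha.
have [c Sc hc] := SZ _ _ _ t0 Sa.
have := ge_inf (Sb _) Sc; lra.
Qed.

Let shift (q : V -> R) v x : set R :=
  [set q (x + t *: v) - t * q v | t in [set t | 0 <= t]].

(* The sublinear functional [x |-> inf_(t >= 0) q (x + t v) - t q v] is below
   [q] and takes at [- v] the least possible value [- q v]. *)
Lemma sublinear_shift (q : V -> R) v : sublinear q ->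
  exists q', [/\ sublinear q', forall x, q' x <= q x & q' (- v) <= - q v].
Proof.
move=> sq.
have lb x : has_lbound (shift q v x).
  exists (- q (- x)) => _ [t /= t0 <-].
  have [->|tn0] := eqVneq t 0.
    by rewrite scale0r addr0 mul0r subr0; exact: sublinearN_ge.
  have tp : 0 < t by rewrite lt_neqAle eq_sym tn0.
  have := sq.1 (x + t *: v) (- x).
  by rewrite addrAC subrr add0r (sublinearZ _ sq tp); lra.
have ne x : shift q v x !=set0.
  by exists (q (x + 0 *: v) - 0 * q v); exists 0 => /=.
exists (fun x => inf (shift q v x)); split.
- apply: inf_sublinear => //.
    move=> x y _ _ [s /= s0 <-] [t /= t0 <-].
    exists (q (x + y + (s + t) *: v) - (s + t) * q v).
      by exists (s + t) => //=; exact: addr_ge0.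
    have := sq.1 (x + s *: v) (y + t *: v).
    by rewrite addrACA -scalerDl; lra.
  move=> s x _ s0 [t /= t0 <-].
  exists (q (s *: x + (s * t) *: v) - (s * t) * q v).
    by exists (s * t) => //=; rewrite mulr_ge0// ltW.
  rewrite -scalerA -scalerDr (sublinearZ _ sq s0); lra.
- move=> x; apply: ge_inf => //; exists 0 => //=.
  by rewrite scale0r addr0 mul0r subr0.
- apply: ge_inf => //; exists 1 => //=.
  by rewrite scale1r addNr (sublinear0 sq) mul1r sub0r.
Qed.

(* A minimal sublinear functional equals its shifts, hence is odd. *)
Lemma minimal_sublinear_linear (q : V -> R) : sublinear q ->
  (forall q', sublinear q' -> (forall x, q' x <= q x) -> q' = q) ->
  linear (q : V -> R^o).
Proof.
move=> sq qmin.
have qN x : q (- x) = - q x.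
  have [q' [sq' q'q q'x]] := sublinear_shift x sq.
  rewrite (qmin _ sq' q'q) in q'x.
  by apply/eqP; rewrite eq_le q'x/=; have := sublinearN_ge (-x) sq; rewrite opprK.
have qD x y : q (x + y) = q x + q y.
  apply/eqP; rewrite eq_le sq.1/=.
  by have := sq.1 (- x) (- y); rewrite -opprD !qN; lra.
move=> t x y; rewrite qD; congr (_ + _); change (q (t *: x) = t * q x).
have [t0|t0|->] := ltgtP t 0; last by rewrite scale0r mul0r (sublinear0 sq).
  have := sublinearZ x sq (_ : 0 < - t); rewrite oppr_gt0 => /(_ t0).
  by rewrite scaleNr qN mulNr => /oppr_inj.
exact: sublinearZ.
Qed.

(** Zorn's lemma below [p]: a nonempty chain has its pointwise infimum as lower bound, finite
    because [q <= p] forces [q x >= - p (- x)]. *)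
Lemma exists_minimal_sublinear (p : V -> R) : sublinear p ->
  exists q, [/\ sublinear q, forall x, q x <= p x &
    forall q', sublinear q' -> (forall x, q' x <= q x) -> q' = q].
Proof.
move=> sp.
pose T := {q : V -> R | sublinear q /\ forall x, q x <= p x}.
(* The order is reversed, so that a maximal element is a minimal functional. *)
pose ge (q q' : T) : bool := `[< forall x, sval q' x <= sval q x >].
have [|||A Atot|q qmin] := @Zorn T ge.
- by move=> q; apply/asboolP.
- move=> q1 q2 q3 /asboolP h1 /asboolP h2; apply/asboolP => x.
  exact: le_trans (h2 x) (h1 x).
- move=> [q1 s1] [q2 s2] /asboolP/= h1 /asboolP/= h2.
  have e : q1 = q2 by apply/funext => x; apply/eqP; rewrite eq_le h1 h2.
  by move: s1 s2; rewrite e => s1 s2; rewrite (Prop_irrelevance s1 s2).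
- have [[q0 Aq0]|A0] := pselect (exists s : T, A s); last first.
    have tp : sublinear p /\ forall x, p x <= p x by [].
    exists (exist _ p tp : T) => q Aq.
    by exfalso; apply: A0; exists q.
  pose S x : set R := [set sval q x | q in A].
  have ne x : S x !=set0 by exists (sval q0 x); exists q0.
  have lb x : has_lbound (S x).
    exists (- p (- x)) => _ [q Aq <-]; have [sq qp] := svalP q.
    by have := sublinearN_ge x sq; have := qp (- x); lra.
  have sS : sublinear (fun x => inf (S x)).
    apply: inf_sublinear => //.
      move=> x y _ _ [q1 A1 <-] [q2 A2 <-].
      have [s1 _] := svalP q1; have [s2 _] := svalP q2.
      have [/asboolP h|/asboolP h] := Atot _ _ A1 A2.
        exists (sval q2 (x + y)); first by exists q2.
        by have := s2.1 x y; have := h x; lra.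
      exists (sval q1 (x + y)); first by exists q1.
      by have := s1.1 x y; have := h y; lra.
    move=> t x _ t0 [q Aq <-]; exists (sval q (t *: x)); first by exists q.
    by have [sq _] := svalP q; exact: sq.2.
  have Sp x : inf (S x) <= p x.
    have [_ qp] := svalP q0; apply: le_trans (qp x).
    by apply: ge_inf => //; exists q0.
  pose s : T := exist _ (fun x => inf (S x)) (conj sS Sp).
  exists s => q Aq; apply/asboolP => x /=.
  by apply: ge_inf => //; exists q.
have [sq qp] := svalP q; exists (sval q); split => // q' sq' q'q.
have q'p x : q' x <= p x by exact: le_trans (q'q x) (qp x).
pose t : T := exist _ q' (conj sq' q'p).
by rewrite -(qmin t)//; apply/asboolP.
Qed.

(** Shifting [p] along [v] gives [p' (- v) <= - p v]; a minimal [g] below [p'] then satisfies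
    [g v >= - g (- v) >= p v]. *)
Theorem hahn_banach_sublinear (p : V -> R) v : sublinear p ->
  exists g : V -> R,
    [/\ linear (g : V -> R^o), forall x, g x <= p x & p v <= g v].
Proof.
move=> sp; have [p' [sp' p'p p'v]] := sublinear_shift v sp.
have [g [sg gp' gmin]] := exists_minimal_sublinear sp'.
have glin := minimal_sublinear_linear sg gmin.
exists g; split=> //; first by move=> x; exact: le_trans (gp' x) (p'p x).
have := sublinearN_ge v sg; have := gp' (- v); lra.
Qed.

End HahnBanach.

(** * Separation in locally convex spaces *)

Lemma absorbing_nbhs0 (R : realType) (L : tvsType R) (U : set L) x :
  nbhs 0 U -> exists2 t : R, 0 < t & U (t *: x).
Proof.
move=> U0; have := @scale_continuous _ L (0, x) U; rewrite /= scale0r => /(_ U0).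
move=> [[A B] /= [A0 Bx] AB].
have [e /= e0 eA] := (nbhs_ballP _ _).1 A0.
exists (e / 2); first by rewrite divr_gt0.
apply: (AB (e / 2, x)); split => /=; last exact: nbhs_singleton.
apply: eA; rewrite /ball/= sub0r normrN gtr0_norm ?divr_gt0//; lra.
Qed.

Lemma linear_continuous_nbhs0 (R : realType) (L : tvsType R) (g : L -> R)
    (W : set L) :
  linear (g : L -> R^o) -> nbhs 0 W -> (forall w, W w -> `|g w| <= 1) ->
  continuous g.
Proof.
move=> gl W0 gW x; apply/cvgrPdist_lt => e e0.
have e20 : e / 2 != 0 by rewrite gt_eqF// divr_gt0.
have := nbhsT x (nbhs0Z e20 W0); apply: filterS => _ [_ [w Ww <-] <-].
have -> : g (x + (e / 2) *: w) = e / 2 * g w + g x.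
  by rewrite addrC; exact: gl.
rewrite opprD addrC subrK normrN normrM gtr0_norm ?divr_gt0//.
have := gW _ Ww; have : 0 < e / 2 by rewrite divr_gt0.
by move=> ? h; rewrite (@le_lt_trans _ _ (e / 2))//; [rewrite ler_piMr// ltW|lra].
Qed.

Lemma convex_setP (R : realType) (M : lmodType R) (A : set M) :
  convex_set (A : set (convex_lmodType M)) ->
  forall x y t, 0 <= t -> t <= 1 -> A x -> A y -> A (t *: x + (1 - t) *: y).
Proof.
move=> cA x y t t0 t1 Ax Ay.
have t01 : Itv.spec (@Itv.num_sem R) (Itv.Real `[0%Z, 1%Z]) t.
  by rewrite /Itv.num_sem/= in_itv/= t0 t1 andbT num_real.
have := cA x y (Itv.mk t01); rewrite !inE => /(_ Ax Ay).
by [].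
Qed.

(** [g] is dominated by the Minkowski gauge of a convex neighborhood [B] inside [V], and this gauge
    is at least 1 outside [V]. The intersection of [B] and [- B] serves as [W] for all [v]; its
    symmetry turns [g <= 1] into a bound on the absolute value. *)
Lemma tvs_separation (R : realType) (L : tvsType R) (V : set L) :
  nbhs 0 V -> exists2 W, nbhs 0 W & forall v, ~ V v -> exists g : L -> R,
    [/\ linear (g : L -> R^o), continuous g,
        forall w, W w -> `|g w| <= 1 & 1 <= g v].
Proof.
move=> V0; have [BB Bconv [Bopen Bbasis]] := @locally_convex R L.
have [B [BB0 B0] BV] := Bbasis _ _ V0.
have nB : nbhs 0 B by apply: open_nbhs_nbhs; split=> //; exact: Bopen.
have cB := convex_setP (Bconv _ (mem_set BB0)).
pose S x : set R := [set t | 0 < t /\ B (t^-1 *: x)].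
have lS x : has_lbound (S x) by exists 0 => t [/ltW].
have S0 x : S x !=set0.
  have [t t0 Bt] := absorbing_nbhs0 x nB.
  by exists t^-1; split; rewrite ?invr_gt0// invrK.
have sS : sublinear (fun x => inf (S x)).
  apply: inf_sublinear => //.
    move=> x y a b [a0 Ba] [b0 Bb]; exists (a + b) => //.
    have ab0 : 0 < a + b by exact: addr_gt0.
    split=> //.
    have -> : (a + b)^-1 *: (x + y) =
        (a / (a + b)) *: (a^-1 *: x) + (1 - a / (a + b)) *: (b^-1 *: y).
      rewrite !scalerA scalerDr; congr (_ *: _ + _ *: _); field; lra.
    apply: cB => //; first by rewrite divr_ge0// ltW.
    by rewrite ler_pdivrMr// mul1r lerDl ltW.
  move=> t x a t0 [a0 Ba]; exists (t * a) => //; split; first exact: mulr_gt0.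
  by rewrite scalerA invfM mulrAC mulVf ?gt_eqF// mul1r.
exists (B `&` -%R @` B).
  by apply: filterI => //; exact: nbhs0N.
move=> v nVv.
have [g [gl gp gv]] := hahn_banach_sublinear v sS.
have gB w : B w -> g w <= 1.
  move=> Bw; apply: le_trans (gp w) _; apply: ge_inf => //.
  by split=> //; rewrite invr1 scale1r.
have gW w : (B `&` -%R @` B) w -> `|g w| <= 1.
  move=> [Bw [u Bu uw]]; rewrite ler_norml gB// andbT.
  have := gB _ Bu.
  have -> : g w = - g u.
    rewrite -uw -scaleN1r -[_ *: _]addr0.
    have -> : g (-1 *: u + 0) = -1 * g u + g 0 by exact: gl.
    have := gl 0 0 0; rewrite scaler0 add0r.
    rewrite /GRing.scale/= mul0r add0r => _.
    have : g (1 *: 0 + 0) = 1 * g 0 + g 0 by exact: gl.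
    by rewrite scaler0 addr0; lra.
  by lra.
exists g; split=> //.
  apply: (linear_continuous_nbhs0 gl _ gW).
  by apply: filterI => //; exact: nbhs0N.
apply: le_trans gv; apply: lb_le_inf => // t [t0 Bt].
(* If [t < 1], then [v] lies on the segment from 0 to [t^-1 *: v] in [B], hence in [V]. *)
rewrite leNgt; apply/negP => t1; apply: nVv; apply: BV.
have -> : v = t *: (t^-1 *: v) + (1 - t) *: 0.
  by rewrite scaler0 addr0 scalerA divff ?gt_eqF// scale1r.
by apply: cB => //; exact: ltW.
Qed.

(** * The normed space of bounded functions *)

Section BoundedFunctions.
Context (R : realType) (T : Type).

Definition bounded_pred : {pred T -> R} :=
  fun f => `[< exists M, forall t, `|f t| <= M >].

Lemma bounded_submod_closed : submod_closed bounded_pred.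
Proof.
split; first by apply/asboolP; exists 0 => t; rewrite normr0.
move=> a f g /asboolP[M fM] /asboolP[N gN]; apply/asboolP.
exists (`|a| * M + N) => t; apply: le_trans (ler_normD _ _) _.
by apply: lerD => //; rewrite normrM ler_wpM2l.
Qed.

HB.instance Definition _ :=
  GRing.isSubmodClosed.Build R (T -> R) bounded_pred bounded_submod_closed.

(** A type of its own, so that it can carry the supremum norm and be a target in the universal
    property. *)
Record bfun := BFun { bfun_val :> T -> R; _ : bfun_val \in bounded_pred }.

HB.instance Definition _ := [isSub for bfun_val].
HB.instance Definition _ := [Choice of bfun by <:].
HB.instance Definition _ := [SubChoice_isSubLmodule of bfun by <:].

Definition bfun_norm (f : bfun) : R := sup [set `|f t| | t in [set: T]].

Lemma bfun_norm_ub (f : bfun) t : `|f t| <= bfun_norm f.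
Proof.
apply: ub_le_sup; last by exists t.
have /asboolP[M fM] := valP f.
by exists M => y [s _ <-]; exact: fM.
Qed.

Lemma bfun_norm_le (f : bfun) M :
  0 <= M -> (forall t, `|f t| <= M) -> bfun_norm f <= M.
Proof.
move=> M0 fM; rewrite /bfun_norm.
have [->|ne] := eqVneq [set `|f t| | t in [set: T]] set0; first by rewrite sup0.
by apply: ge_sup; [exact/set0P|move=> _ [t _ <-]; exact: fM].
Qed.

Lemma bfun_norm_ge0 (f : bfun) : 0 <= bfun_norm f.
Proof.
have [[t _]|nT] := pselect (exists t : T, True).
  exact: le_trans (bfun_norm_ub f t).
rewrite /bfun_norm (_ : [set _ | _ in _] = set0) ?sup0//.
by rewrite -subset0 => y [t _ _]; apply: nT; exists t.
Qed.

Lemma bfun_normD (f g : bfun) : bfun_norm (f + g) <= bfun_norm f + bfun_norm g.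
Proof.
apply: bfun_norm_le => [|t]; first by rewrite addr_ge0// bfun_norm_ge0.
by apply: le_trans (ler_normD _ _) _; apply: lerD; exact: bfun_norm_ub.
Qed.

Lemma bfun_normZ (a : R) (f : bfun) : bfun_norm (a *: f) = `|a| * bfun_norm f.
Proof.
have le b (g : bfun) : bfun_norm (b *: g) <= `|b| * bfun_norm g.
  apply: bfun_norm_le => [|t]; first by rewrite mulr_ge0// bfun_norm_ge0.
  by rewrite /= normrM ler_wpM2l// bfun_norm_ub.
have [->|a0] := eqVneq a 0.
  apply/eqP; rewrite eq_le le/= normr0 mul0r; exact: bfun_norm_ge0.
apply/eqP; rewrite eq_le le/= -ler_pdivlMl ?normr_gt0// -normfV.
by apply: le_trans (le _ _); rewrite scalerA mulVf// scale1r.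
Qed.

Lemma bfun_norm_eq0 (f : bfun) : bfun_norm f = 0 -> f = 0.
Proof.
move=> f0; apply: val_inj; apply/funext => t /=; apply/eqP.
by rewrite -normr_le0 -f0; exact: bfun_norm_ub.
Qed.

HB.instance Definition _ :=
  @Lmodule_isNormed.Build R bfun bfun_norm bfun_normD bfun_normZ bfun_norm_eq0.

End BoundedFunctions.

(** * Compact sets of continuous functions *)

Definition Ck_fun (R : realType) (X : topologicalType) (f : Ck R X) : X -> R :=
  (f : continuousType X R).

Local Coercion Ck_fun : Ck >-> Funclass.

Section Ck.
Context (R : realType) (X : topologicalType).

Lemma Ck_continuous (f : Ck R X) : continuous f.
Proof. exact: (@cts_fun _ _ (f : continuousType X R)). Qed.

Definition Ck_mk (f : X -> R) (cf : continuous f) : Ck R X :=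
  HB.pack_for (continuousType X R) f (isContinuous.Build _ _ f cf).

(** At a continuous limit, compact-open convergence is uniform convergence on compact sets. *)
Lemma Ck_cvgP (F : set_system (Ck R X)) (f : Ck R X) : Filter F ->
  F --> f <-> {family compact, @Ck_fun R X @ F --> (f : X -> R)}.
Proof.
move=> FF.
have -> : F --> f <-> {compact-open, @Ck_fun R X @ F --> (f : X -> R)}.
  split=> [Ff A fA|Ff A [_ [[B oB <-] Bf BA]]].
    apply: Ff; exact: (@initial_continuous _ {compact-open, X -> R} (@Ck_fun R X) f).
  by apply: filterS BA _; apply: Ff; exact: open_nbhs_nbhs.
by apply: compact_open_fam_compactP; exact: Ck_continuous.
Qed.

Lemma Ck_near_compact (f : Ck R X) (C : set X) (e : R) : compact C -> 0 < e ->
  nbhs f [set g : Ck R X | forall x, C x -> `|f x - g x| < e].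
Proof.
move=> cC e0; have [] := Ck_cvgP f (nbhs_filter f) => /(_ cvg_id) h _.
apply: (h [set g : X -> R | forall x, C x -> `|f x - g x| < e]).
apply: (@fam_nbhs _ _ _ C [set xy | `|xy.1 - xy.2| < e]) => //.
by rewrite -entourage_from_ballE; exists e.
Qed.

Lemma Ck_near_point (f : Ck R X) x (e : R) : 0 < e ->
  nbhs f [set g : Ck R X | `|f x - g x| < e].
Proof.
move=> e0; have := Ck_near_compact f (@compact_set1 _ x) e0.
by apply: filterS => g; apply.
Qed.

Definition equicont (K : set (Ck R X)) : Prop := forall x e, 0 < e ->
  \forall y \near x, forall f, K f -> `|f x - f y| < e.

(** Even continuity controls values on a product neighborhood of each [(f, x)]; compactness of [K]
    leaves one neighborhood of [x] for all of [K]. *)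
Lemma ascoli_equicont (K : set (Ck R X)) :
  ascoli_space R X -> compact K -> equicont K.
Proof.
move=> aX cK x e e0.
move: (cK) => /compact_near_coveringP/near_covering_withinP ncK.
apply: (ncK X (nbhs x) (fun y f => `|f x - f y| < e)) => f Kf.
have e20 : 0 < e / 2 by rewrite divr_gt0.
have KT : (K `*` [set: X]) (f, x) by [].
have /subspace_continuousP/(_ _ KT)/cvgrPdist_lt/(_ _ e20) := aX _ cK.
rewrite near_withinE => -[[A B] /= [fA xB] AB].
exists (A, B) => // -[h y] /= [Ah By] Kh.
have := AB (h, y) (conj Ah By) (conj Kh I).
have := AB (h, x) (conj Ah (nbhs_singleton xB)) (conj Kh I).
rewrite /Ck_eval/= -!/(Ck_fun _) => hx hy.
have -> : h x - h y = (f x - h y) - (f x - h x) by ring.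
by apply: le_lt_trans (ler_normB _ _) _; lra.
Qed.

Lemma equicont_ascoli :
  (forall K : set (Ck R X), compact K -> equicont K) -> ascoli_space R X.
Proof.
move=> eqK K cK; apply/subspace_continuousP => -[f x] [/= Kf _].
apply/cvgrPdist_lt => e e0; rewrite near_withinE.
have e20 : 0 < e / 2 by rewrite divr_gt0.
exists ([set g : Ck R X | `|f x - g x| < e / 2],
    [set y | forall g, K g -> `|Ck_fun g x - g y| < e / 2]).
  by split; [exact: Ck_near_point|exact: eqK].
move=> [g y] /= [fg gxy] [Kg _]; rewrite /Ck_eval/= -!/(Ck_fun _).
have -> : f x - g y = (f x - g x) + (g x - g y) by ring.
by apply: le_lt_trans (ler_normD _ _) _; have := gxy _ Kg; lra.
Qed.

(** Functions near [f] are bounded at [x] by [|f x| + 1]; letting [M] tend to infinity replaces a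
    maximum over a finite subcover. *)
Lemma compact_Ck_bounded (K : set (Ck R X)) x : compact K ->
  exists M, forall f, K f -> `|f x| <= M.
Proof.
move=> /compact_near_coveringP/near_covering_withinP ncK.
have : \forall M \near +oo, K `<=` [set f : Ck R X | `|f x| <= M].
  apply: (ncK R (pinfty_nbhs R) (fun M f => `|Ck_fun f x| <= M)) => f Kf.
  exists ([set g : Ck R X | `|f x - g x| < 1], [set M | `|f x| + 1 <= M]).
    by split; [exact: Ck_near_point|exact: nbhs_pinfty_ge].
  move=> [g M] [/= fg fM] _; apply: le_trans fM => /=.
  have -> : Ck_fun g x = f x - (f x - Ck_fun g x) by ring.
  by apply: le_trans (ler_normB _ _) _; lra.
by move=> /filter_ex[M MK]; exists M.
Qed.
End Ck.

(** * Duality between the free locally convex space and [Ck] *)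

Lemma linear_at0 (R : realType) (V W : lmodType R) (g : V -> W) :
  linear g -> g 0 = 0.
Proof.
move=> gl; have := gl 1 0 0; rewrite !scale1r addr0 => /esym/eqP.
by rewrite -subr_eq0 addrK => /eqP.
Qed.

(** [ext] inverts restriction along [i], identifying continuous functions on [X] with continuous
    linear functionals on [L]. *)
Definition is_extension (R : realType) (X : topologicalType) (L : tvsType R)
    (i : X -> L) (ext : Ck R X -> L -> R) : Prop :=
  (forall f, [/\ linear (ext f : L -> R^o), continuous (ext f)
     & forall x, ext f (i x) = f x]) /\
  (forall (g : L -> R) (f : Ck R X), linear (g : L -> R^o) -> continuous g ->
     (forall x, g (i x) = f x) -> g = ext f).

Lemma exists_extension (R : realType) (X : topologicalType) (L : tvsType R)
    (i : X -> L) : free_lcs i -> exists ext, is_extension i ext.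
Proof.
move=> [_ _ univ].
have h (f : Ck R X) : exists g : L -> R, (fun g : L -> R =>
    [/\ linear (g : L -> R^o), continuous g & forall x, g (i x) = f x]) g /\
   (forall g' : L -> R, linear (g' : L -> R^o) -> continuous g' ->
     (forall x, g' (i x) = f x) -> g' = g).
  have [g [[gl gc fg] gu]] :=
    univ R^o f (@norm_hausdorff _ R^o) (@Ck_continuous _ _ f).
  exists g; split; first by split => // x; rewrite fg.
  move=> g' g'l g'c g'i; apply: esym; apply: gu; split => //.
  by apply/funext => x; rewrite /= g'i.
exists (fun f => sval (cid (h f))); split => [f|g f gl gc gf].
  by have [] := svalP (cid (h f)).
by have [_] := svalP (cid (h f)); apply.
Qed.

Lemma ultra_compact_cvg (T : Type) (Y : topologicalType) (F : set_system T)
    (f : T -> Y) (K : set Y) :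
  UltraFilter F -> compact K -> F (f @^-1` K) -> exists l : Y, f @ F --> l.
Proof.
move=> FU cK FK; have [l [_ Fl]] := cK (f @ F) _ FK.
exists l => A nA; have [//|FnA] := in_ultra_setVsetC (f @^-1` A) FU.
by have [y []] := Fl (~` A) A FnA nA.
Qed.

Section FreeLcs.
Context (R : realType) (X : topologicalType) (L : tvsType R) (i : X -> L).
Context (hL : free_lcs i) (ext : Ck R X -> L -> R) (hext : is_extension i ext).

(* The universal property is applied to [x |-> (f x)_(f in K)], a continuous map
   into the bounded functions on [K]. *)
Lemma polar_nbhs0 (K : set (Ck R X)) :
  equicont K -> (forall x, exists M, forall f, K f -> `|f x| <= M) ->
  nbhs 0 [set v | forall f, K f -> `|ext f v| < 1].
Proof.
move=> eK bK; pose T := {f | K f}.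
have Jb x : (fun t : T => sval t x) \in @bounded_pred R T.
  apply/asboolP; have [M KM] := bK x; exists M => -[f Kf]; exact: KM.
pose J x : bfun R T := BFun (Jb x).
have Jc : continuous J.
  move=> x; apply/cvgrPdist_lt => e e0.
  have e20 : 0 < e / 2 by rewrite divr_gt0.
  apply: filterS (eK x _ e20) => y xy; apply: (@le_lt_trans _ _ (e / 2)).
    by apply: bfun_norm_le => [|[f Kf]]; [exact: ltW|exact/ltW/xy].
  lra.
have [_ _ univ] := hL.
have [|G [[Gl Gc JG] _]] := univ _ J _ Jc; first exact: norm_hausdorff.
have G0 : G 0 = 0 := linear_at0 Gl.
(* The coordinate of [G] at [f] is a continuous linear functional restricting to [f] along [i], so
   uniqueness makes it [ext f]. *)
have Gext f (Kf : K f) v : ext f v = G v (exist _ f Kf).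
  suff -> : ext f = fun v => G v (exist _ f Kf) by [].
  apply: esym; apply: hext.2 => [a x y|x|x].
  - by rewrite Gl.
  - apply/cvgrPdist_lt => e e0.
    have /cvgrPdist_lt/(_ e e0) := Gc x; apply: filterS => y.
    by apply: le_lt_trans; exact: (bfun_norm_ub (G x - G y)).
  - by have := congr1 (fun h => h x) JG => /= <-.
have /cvgrPdist_lt/(_ 1 ltr01) := Gc 0; apply: filterS => v.
rewrite G0 sub0r normrN => Gv f Kf; rewrite (Gext _ Kf).
by apply: le_lt_trans Gv; exact: bfun_norm_ub.
Qed.

(* An ultrafilter on the polar converges pointwise on all of [L]; the limit is
   linear and bounded by 1 on [U], hence continuous. *)
Lemma polar_compact (U : set L) : nbhs 0 U ->
  compact [set f : Ck R X | forall v, U v -> `|ext f v| <= 1].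
Proof.
move=> U0; pose P := [set f : Ck R X | forall v, U v -> `|ext f v| <= 1].
have Pbound v : exists M : R, forall f, P f -> `|ext f v| <= M.
  have [t t0 Ut] := absorbing_nbhs0 v U0; exists t^-1 => f Pf.
  have := Pf _ Ut; have [fl _ _] := hext.1 f.
  have -> : ext f (t *: v) = t * ext f v.
    rewrite -[t *: v]addr0; have -> : ext f (t *: v + 0) = t * ext f v + ext f 0.
      exact: fl.
    by rewrite (linear_at0 fl) addr0.
  by rewrite normrM gtr0_norm// -ler_pdivlMl// mulr1.
have Pequi : equicont P.
  move=> x e e0; have [_ ic _] := hL.
  have e20 : e / 2 != 0 by rewrite gt_eqF// divr_gt0.
  (* On the translate of [(e / 2) U] to [i x], every functional in the polar varies by at most
     [e / 2]. *)
  have : nbhs x (i @^-1` (+%R (i x) @` ( *:%R (e / 2) @` U))).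
    exact: ic x _ (nbhsT (i x) (nbhs0Z e20 U0)).
  apply: filterS => y [_ [u Uu <-] xy] f Pf; have [fl _ fi] := hext.1 f.
  rewrite -!fi -xy [i x + _]addrC.
  have -> : ext f ((e / 2) *: u + i x) = (e / 2) * ext f u + ext f (i x).
    exact: fl.
  rewrite opprD addrC subrK normrN normrM gtr0_norm ?divr_gt0//.
  apply: (@le_lt_trans _ _ (e / 2)); last by lra.
  by rewrite ler_piMr ?divr_ge0// ?Pf// ltW.
rewrite compact_ultra => F FU FP.
have lim v : exists l, (fun f => ext f v) @ F --> (l : R).
  have [M PM] := Pbound v.
  apply: (ultra_compact_cvg FU (@segment_compact R (- M) M)).
  apply: filterS FP => f Pf; rewrite /= in_itv/=.
  by have := PM _ Pf; rewrite ler_norml.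
pose h v := sval (cid (lim v)).
have hP v : (fun f => ext f v) @ F --> h v := svalP (cid (lim v)).
have hl : linear (h : L -> R^o).
  move=> a x y.
  have : (fun f => ext f (a *: x + y)) @ F --> (a * h x + h y : R).
    rewrite (_ : (fun _ => _) = (fun f => a * ext f x + ext f y)).
      by apply: cvgD => //; apply: cvgM => //; exact: cvg_cst.
    by apply/funext => f; have [fl _ _] := hext.1 f; exact: fl.
  by move=> h1; exact: (cvg_unique (@norm_hausdorff _ R^o) (hP _) h1).
have hU v : U v -> `|h v| <= 1.
  move=> Uv; rewrite leNgt; apply/negP => hv1.
  have hv0 : 0 < `|h v| - 1 by rewrite subr_gt0.
  have /cvgrPdist_lt/(_ _ hv0) hF := hP v.
  have [f [/= fh /(_ _ Uv)]] := filter_ex (filterI hF FP).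
  have := lerB_dist (h v) (ext f v); lra.
have hc : continuous h := linear_continuous_nbhs0 hl U0 hU.
have hic : continuous (h \o i).
  by have [_ ic _] := hL; move=> x; apply: continuous_comp; [exact: ic|exact: hc].
exists (Ck_mk hic); split.
  move=> v Uv; have <- : h = ext (Ck_mk hic) by exact: hext.2.
  exact: hU.
(* By equicontinuity of the polar, pointwise convergence of [F] upgrades to convergence on compact
   sets. *)
have eqF : \forall W \near powerset_filter_from
    ((@Ck_fun R X @ F) : set_system {ptws X -> R}), equicontinuous W id.
  apply/near_powerset_filter_fromP; first exact: equicontinuous_subset_id.
  exists (@Ck_fun R X @` P).
    suff : F (@Ck_fun R X @^-1` (@Ck_fun R X @` P)) by [].
    by apply: filterS FP => f Pf; exists f.
  move=> x E; rewrite -entourage_from_ballE => -[e /= e0 eE].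
  apply: filterS (Pequi x e e0) => y xy _ [f Pf <-]; apply: eE.
  exact: xy.
apply/Ck_cvgP; apply/(pointwise_compact_cvg _ _ eqF).
apply/pointwise_cvgP => x.
have exti : (fun f => ext f (i x)) = (fun f : Ck R X => f x).
  by apply/funext => f; have [_ _ ->] := hext.1 f.
by have := hP (i x); rewrite exti.
Qed.

(** Polars reverse inclusions, which turns one monotonicity into the other. A compact set is
    swallowed because its polar in [L] contains some [U a]; conversely the polar of [K a] is small
    once [K a] contains the polar of a small neighborhood. *)
Lemma G_base_compact_resolution : ascoli_space R X ->
  G_base_at (0 : L) <->
  exists K : (nat -> nat) -> set (Ck R X),
    compact_resolution K /\ swallows_compacts K.
Proof.
move=> aX; split=> [[U [U0 Ubase Umon]]|[K [[Kc _ Kmon] Ksw]]].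
  pose K a := [set f : Ck R X | forall v, U a v -> `|ext f v| <= 1].
  exists K; split; last first.
    move=> C cC; have [|a Ua] := Ubase _ (polar_nbhs0 (ascoli_equicont aX cC) _).
      by move=> x; exact: compact_Ck_bounded.
    by exists a => f Cf v /Ua/(_ f Cf)/ltW.
  split=> [a||a b ab f Kf v /(Umon _ _ ab)]; [exact: polar_compact| |exact: Kf].
  apply/seteqP; split=> // f _.
  have [fl fc _] := hext.1 f.
  have [a Ua] : exists a, U a `<=` [set v | `|ext f v| < 1].
    apply: Ubase; have /cvgrPdist_lt/(_ 1 ltr01) := fc 0.
    by apply: filterS => v; rewrite (linear_at0 fl) sub0r normrN.
  by exists a => // v /Ua/ltW.
exists (fun a => [set v | forall f, K a f -> `|ext f v| < 1]); split.
- move=> a; apply: polar_nbhs0; first exact: ascoli_equicont.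
  by move=> x; exact: compact_Ck_bounded.
- move=> V V0; have [W W0 Wsep] := tvs_separation V0.
  have [a Wa] := Ksw _ (polar_compact W0).
  (* If [v] were outside [V], a separating functional would restrict to an element of the polar of
     [W], hence of [K a], and be at least 1 at [v]. *)
  exists a => v Kv; apply: contrapT => nVv.
  have [g [gl gc gW gv]] := Wsep _ nVv.
  have gic : continuous (g \o i).
    have [_ ic _] := hL; move=> x.
    by apply: continuous_comp; [exact: ic|exact: gc].
  have gE : g = ext (Ck_mk gic) by exact: hext.2.
  have Kg : K a (Ck_mk gic) by apply: Wa => w; rewrite -gE; exact: gW.
  by have := Kv _ Kg; rewrite -gE; have := ler_norm (g v); lra.
- by move=> a b ab v Kv f /(Kmon _ _ ab); exact: Kv.
Qed.

End FreeLcs.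

Lemma has_G_base_at0 (R : realType) (L : tvsType R) :
  has_G_base L <-> G_base_at (0 : L).
Proof.
split=> [|[U [U0 Ubase Umon]] z]; first exact.
exists (fun a => +%R z @` U a); split=> [a|V Vz|a b ab].
- exact: nbhsT.
- have := nbhsB (- z) Vz; rewrite addNr => /Ubase[a Ua]; exists a.
  by move=> _ [v /Ua[w Vw <-] <-]; rewrite addrA subrr add0r.
- by apply: image_subset; exact: Umon.
Qed.

(** * Dieudonne completeness *)

(** Entourages are kept apart from any topology on the carrier, so that a uniform structure can be
    built on a space that already has one. *)
Record uniformity (T : Type) := Uniformity {
  ent : set_system (T * T);
  ent_filter : Filter ent;
  ent_refl : forall E, ent E -> diagonal `<=` E;
  ent_inv : forall E, ent E -> ent E^-1%relation;
  ent_split : forall E, ent E -> exists2 E', ent E' &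
    (E' \; E')%relation `<=` E }.

(** An alias, so that the topology induced by the entourages does not clash with the one on [T]. *)
Definition uniform_carrier (T : choiceType) of uniformity T : Type := T.

HB.instance Definition _ (T : choiceType) (e : uniformity T) :=
  Choice.copy (uniform_carrier e) T.
HB.instance Definition _ (T : choiceType) (e : uniformity T) :=
  isUniform.Build (uniform_carrier e)
    (ent_filter e) (@ent_refl _ e) (@ent_inv _ e) (@ent_split _ e).

Lemma dieudonne_complete_uniformity (X : topologicalType) (e : uniformity X) :
  (forall x U, nbhs x U <-> exists2 E, ent e E & forall y, E (x, y) -> U y) ->
  (forall F : set_system X, ProperFilter F ->
     (forall E, ent e E -> exists2 A, F A & forall x y, A x -> A y -> E (x, y)) ->
     exists x : X, F --> x) ->
  dieudonne_complete X.
Proof.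
move=> en ec; exists (Uniform.class (uniform_carrier e : uniformType)).
set UX := Uniform.Pack _ => /=.
have nE (x : X) : @nbhs UX UX x = @nbhs X X x.
  apply/funext => U; apply/propext; rewrite en; split.
    move=> [E entE EU]; exists E => // y Exy; apply: EU.
    exact/xsectionP.
  move=> [E entE EU]; exists E => // y /xsectionP; exact: EU.
split=> // F FF Fc.
have [|x Fx] := ec F FF; last by exists x; rewrite /cvg_to nE.
move=> E entE.
have [[A B] /= [FA FB] AB] := Fc E entE.
exists (A `&` B); first exact: filterI.
by move=> x y [Ax _] [_ By]; exact: (AB (x, y)).
Qed.

Lemma filter_finite_forall (T : Type) (I : choiceType) (F : set_system T)
    (S : set I) (P : I -> set T) : Filter F -> finite_set S ->
  (forall s, S s -> F (P s)) -> F [set t | forall s, S s -> P s t].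
Proof.
move=> FF /finite_fsetP[A ->] FP.
by have := @filter_bigI _ _ A P F FF FP; apply: filterS => t Pt s; exact: Pt.
Qed.

(* The neighborhood consists of the pairs [(z, y)] such that [y] lies in the set
   chosen for [V], for each member [V] of a locally finite refinement whose
   closure contains [z]. *)
Lemma paracompact_diagonal_nbhs (X : topologicalType) (U : X -> set X) :
  regular_space X -> paracompact_space X -> (forall x, open_nbhs x (U x)) ->
  exists2 N : set (X * X), forall x, nbhs ((x, x) : (X * X)%type) N &
    forall z, exists x, forall y, N (z, y) -> U x y.
Proof.
move=> reg para Uo.
(* [x0] will be the default value of [c] outside [D]. *)
have [[x0 _]|X0] := pselect (exists x : X, True); last first.
  by exists setT => x; exfalso; apply: X0; exists x.
have [W Wn WU] : exists2 W : X -> set X, forall x, nbhs x (W x) &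
    forall x, closure (W x) `<=` U x.
  have h x : exists W : set X, nbhs x W /\ closure W `<=` U x.
    by have [W nW WU] := reg x _ (open_nbhs_nbhs (Uo x)); exists W.
  by exists (fun x => sval (cid (h x))) => x; have [] := svalP (cid (h x)).
have [||D [Do Dcov Dref Dlf]] := para [set (W x)^° | x in [set: X]].
- by move=> _ [x _ <-]; exact: open_interior.
- apply/seteqP; split=> // x _; exists (W x)^°; first by exists x.
  exact: Wn.
have [c cW] : exists c : set X -> X, forall V, D V -> closure V `<=` U (c V).
  have h V : exists x, D V -> closure V `<=` U x.
    have [DV|nDV] := pselect (D V); last by exists x0.
    have [_ [x _ <-] Vx] := Dref _ DV; exists x => _.
    apply: subset_trans (WU x); apply: closure_subset.
    exact: subset_trans Vx (@interior_subset _ _).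
  by exists (fun V => sval (cid (h V))) => V; exact: svalP (cid (h V)).
exists [set p | forall V, D V -> closure V p.1 -> U (c V) p.2].
  move=> x; have [M nM Mfin] := Dlf x.
  pose S := [set V | D V /\ V `&` M !=set0].
  have nS : nbhs ((x, x) : (X * X)%type) [set p : X * X |
      forall V, S V -> closure V p.1 -> U (c V) p.2].
    apply: filter_finite_forall => // V [DV _].
    have [xV|xV] := pselect (closure V x).
      exists (setT, U (c V)); last by move=> [y z] [].
      split; first exact: filterT.
      by apply: open_nbhs_nbhs; split; [exact: (Uo _).1|exact: cW].
    exists (~` closure V, setT); last by move=> [y z] [].
    split; last exact: filterT.
    by apply: open_nbhs_nbhs; split => //; exact/closed_openC/closed_closure.
  have nM1 : nbhs ((x, x) : (X * X)%type) [set p : X * X | M^° p.1].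
    exists (M^°, setT); last by move=> [y z] [].
    by split; [exact: nbhs_interior|exact: filterT].
  apply: filterS (filterI nS nM1) => -[y z] /= [Sy My] V DV Vy.
  by apply: Sy => //; split => //; exact: Vy.
move=> z; have [V DV Vz] : (\bigcup_(V in D) V) z by rewrite Dcov.
by exists (c V) => y; apply => //; exact: subset_closure.
Qed.

(** If a Cauchy filter had no limit, each [x] would have an open neighborhood [U x] not in the
    filter; yet a member that is small for the [N] of [paracompact_diagonal_nbhs] lies in some
    [U x]. *)
Lemma paracompact_dieudonne_complete (X : topologicalType) :
  hausdorff_space X -> regular_space X -> paracompact_space X ->
  dieudonne_complete X.
Proof.
move=> hX reg para.
pose e : set_system (X * X) := [set E | forall x, nbhs ((x, x) : (X * X)%type) E].
have eF : Filter e.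
  split=> [x|A B eA eB x|A B AB eA x]; first exact: filterT.
    exact: filterI (eA x) (eB x).
  exact: filterS AB (eA x).
have erefl E : e E -> diagonal `<=` E.
  by move=> eE [x y] /diagonalP <-; exact: nbhs_singleton (eE x).
have einv E : e E -> e E^-1%relation.
  move=> eE x; have [[A B] /= [xA xB] AB] := eE x.
  by exists (B, A) => // -[y z] /= [By Az]; exact: (AB (z, y)).
have esplit E : e E -> exists2 E', e E' & (E' \; E')%relation `<=` E.
  move=> eE.
  have [U Uo UE] : exists2 U : X -> set X, forall x, open_nbhs x (U x) &
      forall x y z, U x y -> U x z -> E (y, z).
    have h x : exists U : set X, open_nbhs x U /\
        forall y z, U y -> U z -> E (y, z).
      have [[A B] /= [xA xB] AB] := eE x.
      exists (A `&` B)^°; split.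
        by split; [exact: open_interior|exact: filterI].
      move=> y z /interior_subset[Ay _] /interior_subset[_ Bz].
      exact: (AB (y, z)).
    exists (fun x => sval (cid (h x))) => x; first by have [] := svalP (cid (h x)).
    by have [_] := svalP (cid (h x)); exact.
  (* Each section of [N] lies in some [U x], so any two of its points form a pair in [E]. *)
  have [N nN NU] := paracompact_diagonal_nbhs reg para Uo.
  exists (N `&` N^-1%relation); first exact: filterI (nN : e N) (einv N nN).
  move=> [y w] [z /= [_ Nzy] [Nzw _]]; have [x Ux] := NU z.
  by apply: (UE x); exact: Ux.
apply: (@dieudonne_complete_uniformity X (Uniformity eF erefl einv esplit)) => /=.
  move=> x U; split=> [nU|[E eE EU]].
    (* A neighborhood of the diagonal, since points are closed; its section at [x] is [U]. *)
    exists [set p | p.1 = x -> U p.2]; last by move=> y; apply.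
    move=> y; have [->|yx] := pselect (y = x).
      exists (setT, U); last by move=> [? ?] [_ Ub] _.
      by split => //; exact: filterT.
    exists (~` [set x], setT); last by move=> [z z0] [/= zx _] /zx.
    split; last exact: filterT.
    apply: open_nbhs_nbhs; split => //; apply: closed_openC.
    exact/accessible_closed_set1/hausdorff_accessible.
  have [[A B] /= [xA xB] AB] := eE x.
  apply: filterS xB => y By; apply: EU; apply: (AB (x, y)).
  by split => //; exact: nbhs_singleton.
move=> F FF Fc; apply: contrapT => nF.
have [U Uo UF] : exists2 U : X -> set X, forall x, open_nbhs x (U x) &
    forall x, ~ F (U x).
  have h x : exists U : set X, open_nbhs x U /\ ~ F U.
    apply: contrapT => nU; apply: nF; exists x => A.
    rewrite nbhsE => -[B oB BA]; apply: filterS BA _.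
    by apply: contrapT => nFB; apply: nU; exists B.
  by exists (fun x => sval (cid (h x))) => x; have [] := svalP (cid (h x)).
have [N nN NU] := paracompact_diagonal_nbhs reg para Uo.
have [A FA AN] := Fc _ nN.
have [a Aa] := filter_ex FA; have [x Ux] := NU a.
by apply: (UF x); apply: filterS FA => y Ay; exact/Ux/AN.
Qed.

(** * Metrizable spaces and the uniformity of continuous pseudometrics *)

Definition is_distance (R : realType) (X : topologicalType) (d : X -> X -> R) :=
  [/\ forall x, d x x = 0, forall x y, d x y = d y x,
      forall x y z, d x z <= d x y + d y z
    & forall x U,
        nbhs x U <-> exists2 e : R, 0 < e & forall y, d x y < e -> U y].

Lemma metrizable_distance (R : realType) (X : topologicalType) :
  metrizable_space R X -> exists d : X -> X -> R, is_distance d.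
Proof.
move=> [mX]; set MX := Metric.Pack mX => /= nE.
exists (@mdist R MX); split.
- exact: (@metric_structure.mdistxx R MX).
- exact: (@metric_sym R MX).
- exact: (@metric_triangle R MX).
- move=> x U; rewrite -nE -(@nbhs_ballE R MX); split.
    by move=> [e e0 eU]; exists e => // y xy; apply: eU; rewrite ballEmdist.
  by move=> [e e0 eU]; exists e => // y; rewrite ballEmdist; exact: eU.
Qed.

Section FineUniformity.
Context (R : realType) (X : topologicalType).

Definition continuous_pseudometric (r : X -> X -> R) : Prop :=
  [/\ forall x, r x x = 0, forall x y, r x y = r y x,
      forall x y z, r x z <= r x y + r y z
    & forall x e, 0 < e -> nbhs x [set y | r x y < e]].

Lemma pseudometric_ge0 r x y : continuous_pseudometric r -> 0 <= r x y.
Proof.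
move=> [r0 rC rD _]; have := rD x y x; rewrite r0 (rC y x); lra.
Qed.

Lemma continuous_pseudometricZ (a : R) r : 0 < a ->
  continuous_pseudometric r -> continuous_pseudometric (fun x y => a * r x y).
Proof.
move=> a0 [r0 rC rD rn]; split=> [x|x y|x y z|x e e0].
- by rewrite r0 mulr0.
- by rewrite rC.
- by rewrite -mulrDr ler_pM2l.
- have ea0 : 0 < e / a by rewrite divr_gt0.
  apply: filterS (rn x _ ea0) => y /=.
  by rewrite ltr_pdivlMr// mulrC.
Qed.

(** This makes continuous real functions uniformly continuous for the uniformity below. *)
Lemma continuous_pseudometric_dist (g : X -> R) : continuous g ->
  continuous_pseudometric (fun x y => `|g x - g y|).
Proof.
move=> gc; split=> [x|x y|x y z|x e e0].
- by rewrite subrr normr0.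
- exact: distrC.
- exact: ler_distD.
- by have /cvgrPdist_lt/(_ _ e0) := gc x.
Qed.

(** Radius 1 suffices, since continuous pseudometrics may be rescaled. *)
Definition fine_ent : set_system (X * X) := [set E | exists2 r,
  continuous_pseudometric r & forall x y, r x y < 1 -> E (x, y)].

Lemma fine_ent_filter : Filter fine_ent.
Proof.
split=> [|A B [r pr rA] [s ps sB]|A B AB [r pr rA]].
- exists (fun _ _ => 0) => //; split=> [//|//|x y z|x e e0]; first by rewrite addr0.
  by apply: filterS filterT.
- exists (fun x y => r x y + s x y); last first.
    move=> x y rs1; have r0 := pseudometric_ge0 x y pr.
    have s0 := pseudometric_ge0 x y ps.
    have xA : A (x, y) by apply: rA; lra.
    have xB : B (x, y) by apply: sB; lra.
    by [].
  case: pr ps => [r0 rC rD rn] [s0 sC sD sn]; split=> [x|x y|x y z|x e e0].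
  + by rewrite r0 s0 addr0.
  + by rewrite rC sC.
  + by have := rD x y z; have := sD x y z; lra.
  + have e20 : 0 < e / 2 by rewrite divr_gt0.
    by apply: filterS (filterI (rn x _ e20) (sn x _ e20)) => y /= []; lra.
- by exists r => // x y /rA; exact: AB.
Qed.

Lemma fine_ent_refl E : fine_ent E -> diagonal `<=` E.
Proof.
by move=> [r [r0 _ _ _] rE] [x y] /diagonalP <-; apply: rE; rewrite r0.
Qed.

Lemma fine_ent_inv E : fine_ent E -> fine_ent E^-1%relation.
Proof.
move=> [r pr rE]; exists r => // x y; have [_ -> _ _] := pr.
exact: rE.
Qed.

Lemma fine_ent_split E :
  fine_ent E -> exists2 E', fine_ent E' & (E' \; E')%relation `<=` E.
Proof.
move=> [r pr rE]; exists [set p | 2 * r p.1 p.2 < 1].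
  by exists (fun x y => 2 * r x y) => //; exact: continuous_pseudometricZ.
move=> [x z] [y /= xy yz]; apply: rE; have [_ _ rD _] := pr.
by have := rD x y z; lra.
Qed.

Definition fine_uniformity : uniformity X :=
  Uniformity fine_ent_filter fine_ent_refl fine_ent_inv fine_ent_split.

(* If [F] is Cauchy without limit, then [g x], the distance from [x] to the
   point of the completion defined by [F], is positive, so [1 / g] is continuous
   but unbounded along [F]. *)
Lemma distance_dieudonne_complete (d : X -> X -> R) :
  is_distance d -> dieudonne_complete X.
Proof.
move=> [d0 dC dD dn].
have nd x e : 0 < e -> nbhs x [set y | d x y < e].
  by move=> e0; apply/dn; exists e.
have pd : continuous_pseudometric d by [].
apply: (@dieudonne_complete_uniformity X fine_uniformity) => /=.
  move=> x U; split=> [/dn[e e0 eU]|[E [r [_ _ _ rn] rE] EU]]; last first.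
    by apply: filterS (rn x 1 ltr01) => y /rE; exact: EU.
  exists [set p | e^-1 * d p.1 p.2 < 1].
    by exists (fun x y => e^-1 * d x y) => //;
      apply: continuous_pseudometricZ => //; rewrite invr_gt0.
  by move=> y /=; rewrite mulrC ltr_pdivrMr// mul1r; exact: eU.
move=> F FF Fc; apply: contrapT => nF.
have small r e : continuous_pseudometric r -> 0 < e ->
    exists2 A, F A & forall x y, A x -> A y -> r x y < e.
  move=> pr e0; have [|A FA AE] := Fc [set p | e^-1 * r p.1 p.2 < 1].
    by exists (fun x y => e^-1 * r x y) => //;
      apply: continuous_pseudometricZ => //; rewrite invr_gt0.
  exists A => // x y Ax Ay; have := AE _ _ Ax Ay.
  by rewrite /= mulrC ltr_pdivrMr// mul1r.
(* The radii of the balls around [x] that belong to [F]. *)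
pose S x : set R := [set r | F [set y | d x y < r]].
have Slb x : has_lbound (S x).
  exists 0 => r Sr; have [y /= xy] := filter_ex Sr.
  by have := pseudometric_ge0 x y pd; lra.
have Sne x : S x !=set0.
  have [A FA A1] := small d 1 pd ltr01; have [a Aa] := filter_ex FA.
  exists (d x a + 1); apply: filterS FA => y Ay /=.
  by have := dD x a y; have := A1 _ _ Aa Ay; lra.
pose g x := inf (S x).
have gle x e : F [set y | d x y < e] -> g x <= e by move=> Fe; exact: ge_inf.
have glip x y : g x <= g y + d x y.
  rewrite -lerBlDr; apply: lb_le_inf => // r Sr; rewrite lerBlDr.
  apply: gle; apply: filterS Sr => z /= yz; have := dD x y z; lra.
have g0 x : 0 < g x.
  rewrite lt_neqAle; apply/andP; split; last first.
    apply: lb_le_inf => // r Sr; have [y /= xy] := filter_ex Sr.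
    by have := pseudometric_ge0 x y pd; lra.
  apply/eqP => gx0; apply: nF; exists x => U /dn[e e0 eU].
  have /(inf_lt (Sne x))[r Sr re] : g x < e by rewrite -gx0.
  by apply: filterS Sr => y /= xy; apply: eU; exact: lt_trans xy re.
have gc : continuous g.
  move=> x; apply/cvgrPdist_lt => e e0; apply: filterS (nd x e e0) => y /= xy.
  rewrite ltr_norml; have := glip x y; have := glip y x; rewrite (dC y x).
  by move=> ? ?; apply/andP; split; lra.
have gVc : continuous (fun x => (g x)^-1).
  by move=> x; apply: cvgV; [rewrite gt_eqF|exact: gc].
(* [1 / g] varies by less than 1 on [A], but a member [B] of [F] with distances below
   [((g a)^-1 + 1)^-1] makes it at least [(g a)^-1 + 1] at some [b] in [A]. *)
have [A FA A1] := small _ 1 (continuous_pseudometric_dist gVc) ltr01.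
have [a Aa] := filter_ex FA.
have M0 : 0 < (g a)^-1 + 1 by rewrite addr_gt0// invr_gt0.
have MV0 : 0 < ((g a)^-1 + 1)^-1 by rewrite invr_gt0.
have [B FB B1] := small d _ pd MV0.
have [b [Ab Bb]] := filter_ex (filterI FA FB).
have : g b <= ((g a)^-1 + 1)^-1.
  by apply: gle; apply: filterS FB => y By; exact: B1.
rewrite -lef_pV2 ?posrE// invrK.
by have := A1 _ _ Aa Ab; rewrite ltr_norml => /andP[]; lra.
Qed.

End FineUniformity.

(** * Ascoli spaces *)

(** A neighborhood of [x] takes all but finitely many terms; the others are treated one by one. *)
Lemma compact_cvg_range (X : topologicalType) (a : nat -> X) (x : X) :
  a @ \oo --> x -> compact (x |` range a).
Proof.
move=> ax; apply/compact_near_coveringP => I F P FF nP.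
have [[V W] /= [xV FW] VW] := nP x (or_introl erefl).
have [N _ NV] := ax _ xV.
have FaN : F [set i | forall n, `I_N n -> P i (a n)].
  apply: filter_finite_forall => // n _.
  have an : (x |` range a) (a n) by right; exists n.
  have [[V' W'] /= [aV FW'] VW'] := nP (a n) an.
  apply: filterS FW' => i Wi; apply: (VW' (a n, i)).
  by split => //; exact: nbhs_singleton.
apply: filterS (filterI FW FaN) => i [Wi aN] y [->|[n _ <-]].
  by apply: (VW (x, i)); split => //; exact: nbhs_singleton.
have [nN|Nn] := ltnP n N; first exact: aN.
by apply: (VW (a n, i)); split => //; exact: NV.
Qed.

Section AscoliSpaces.
Context (R : realType) (X : topologicalType).

(* On a compact set [C], elements of [K] close to [f] in [Ck] are uniformly close
   to [f] on [C]. *)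
Lemma compact_equicont_on (K : set (Ck R X)) (C : set X) x0 (e : R) x :
  compact K -> compact C -> C x -> (forall f, K f -> `|f x0 - f x| < e) ->
  \forall y \near x, C y -> forall f, K f -> `|f x0 - f y| < e.
Proof.
move=> /compact_near_coveringP/near_covering_withinP cK cC Cx Kx.
suff : \forall y \near x, K `<=` [set f : Ck R X | C y -> `|f x0 - f y| < e].
  by apply: filterS => y Ky Cy f Kf; exact: Ky.
apply: (cK X (nbhs x) (fun y f => C y -> `|Ck_fun f x0 - f y| < e)) => f Kf.
(* A third of the slack at [x], for three errors: from [f] to [g] at [x0], from [x] to [y], and from
   [f] to [g] at [y]. *)
pose t := (e - `|f x0 - f x|) / 3.
have t0 : 0 < t by rewrite divr_gt0// subr_gt0 Kx.
have /cvgrPdist_lt/(_ _ t0) fx := @Ck_continuous R X f x.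
exists ([set g : Ck R X | `|f x0 - g x0| < t] `&`
        [set g : Ck R X | forall y, C y -> `|f y - g y| < t],
        [set y | `|f x - f y| < t]).
  split => //; apply: filterI; first exact: Ck_near_point.
  exact: Ck_near_compact.
move=> [g y] [/= [g0 gC] fy] Kg Cy.
have tE : `|f x0 - f x| + 3 * t = e by rewrite /t; field.
have -> : Ck_fun g x0 - Ck_fun g y = - (f x0 - Ck_fun g x0) + (f x0 - f x) +
    (f x - f y) + (f y - Ck_fun g y) by ring.
have := gC _ Cy; move: g0 fy tE; rewrite -normrN.
move: (- _) (f x0 - f x) (f x - f y) (f y - Ck_fun g y) => u v w z.
have := ler_normD (u + v + w) z; have := ler_normD (u + v) w.
have := ler_normD u v; lra.
Qed.

(** Applied to the set of points where some [f] in [K] differs from [f x0] by at least [e]; its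
    complement is the neighborhood of [x0] required by equicontinuity. *)
Lemma ascoli_of_compactly_closed :
  (forall A : set X, (forall C x, compact C -> C x -> ~ A x ->
      \forall y \near x, C y -> ~ A y) -> closed A) ->
  ascoli_space R X.
Proof.
move=> cA; apply: equicont_ascoli => K cK x0 e e0.
pose A := [set x | exists2 f : Ck R X, K f & e <= `|f x0 - f x|].
have /closed_openC oA : closed A.
  apply: cA => C x cC Cx nAx.
  have Kx f : K f -> `|Ck_fun f x0 - f x| < e.
    by move=> Kf; rewrite ltNge; apply/negP => h; apply: nAx; exists f.
  apply: filterS (compact_equicont_on cK cC Cx Kx) => y Cy /Cy Ky [f /Ky].
  by rewrite ltNge => /negP.
have : nbhs x0 (~` A).
  apply: open_nbhs_nbhs; split=> // -[f Kf]; rewrite subrr normr0; lra.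
apply: filterS => y nAy f Kf; rewrite ltNge; apply/negP => h; apply: nAy.
by exists f.
Qed.

Lemma k_space_ascoli : k_space X -> ascoli_space R X.
Proof.
move=> kX; apply: ascoli_of_compactly_closed => A hA; apply: kX => C cC x clx.
apply: contrapT => nAx.
suff nx : @nbhs _ (subspace C) x (~` A) by have [y []] := clx _ nx.
case: (nbhs_subspaceP C x) => [Cx|_ y -> //].
exact: hA Cx nAx.
Qed.

(** A point of the closure of [A] is the limit of a sequence in [A], and the sequence with its limit
    is a compact set to test [A] on. *)
Lemma distance_ascoli (d : X -> X -> R) : is_distance d -> ascoli_space R X.
Proof.
move=> [d0 dC dD dn]; apply: ascoli_of_compactly_closed => A hA x clx.
apply: contrapT => nAx.
have h n : exists y, A y /\ d x y < n.+1%:R^-1.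
  have [|y [Ay xy]] := clx [set y | d x y < n.+1%:R^-1]; last by exists y.
  by apply/dn; exists n.+1%:R^-1 => //; rewrite invr_gt0.
pose a n := sval (cid (h n)).
have aA n : A (a n) by have [] := svalP (cid (h n)).
have ax n : d x (a n) < n.+1%:R^-1 by have [] := svalP (cid (h n)).
have acvg : a @ \oo --> x.
  move=> U /dn[e e0 eU].
  have : \forall n \near \oo, n.+1%:R^-1 < e by
    exact: near_infty_natSinv_lt (PosNum e0).
  by apply: filterS => n ne; apply: eU; exact: lt_trans (ax n) ne.
have nA := hA _ x (compact_cvg_range acvg) (or_introl erefl) nAx.
have [n /=] := @filter_ex _ \oo _ _ (acvg _ nA).
by apply => //; right; exists n.
Qed.

End AscoliSpaces.

(* The second conjunct is the claim on paracompact k-spaces and metrizable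
   spaces. *)
Theorem theorem1p2 (R : realType) (X : topologicalType)
    (hX : tychonoff_space X) :
  (dieudonne_complete X -> ascoli_space R X ->
   forall (L : tvsType R) (i : X -> L), free_lcs i ->
     (has_G_base L <->
      exists K : (nat -> nat) -> set (Ck R X),
        compact_resolution K /\ swallows_compacts K)) /\
  ((paracompact_space X /\ k_space X) \/ metrizable_space R X ->
   dieudonne_complete X /\ ascoli_space R X).
Proof.
case: hX => hX crX; split=> [_ aX L i hL|[[pX kX]|/metrizable_distance[d dX]]].
- have [ext hext] := exists_extension hL.
  by rewrite has_G_base_at0; apply: (G_base_compact_resolution hL hext aX).
- split; last exact: k_space_ascoli.
  apply: paracompact_dieudonne_complete => //.
  exact: (@completely_regular_regular R).
- by split; [exact: distance_dieudonne_complete dX|exact: distance_ascoli dX].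
Qed.
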